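(* Suppose $c$ satisfies (Reg), (Twist) and (QC) (as defined in the context), and $X$ is bounded and $c$-convex with respect to $Y$. There is a universal constant $C>0$ such that if $\psi_1,\psi_2\in\mathbb{R}^N$ satisfy $\langle\psi_1-\psi_2,\mathbf{1}\rangle=0$ and $\mathrm{Lag}_i(\psi_1),\mathrm{Lag}_i(\psi_2)\neq\emptyset$ for every $i\in\{1,\dots,N\}$, then $$\|\psi_1^{c^*}-\psi_2^{c^*}\|_{C^0(X)}\le\frac{C\,N^4\sqrt{\sum_{i=1}^Nd_{\mathcal{H}}(\mathrm{Lag}_i(\psi_1),\mathrm{Lag}_i(\psi_2))^2}}{\left(\max\left(\min_i\mathcal{L}(\mathrm{Lag}_i(\psi_1)),\min_i\mathcal{L}(\mathrm{Lag}_i(\psi_2))\right)\right)^{1-\frac1n}},$$ where the right-hand side is read as $+\infty$ if the denominator vanishes.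
   Context: Fix integers $n\ge2$, $N\ge1$, a compact set $X\subset\mathbb{R}^n$ with Lipschitz boundary, a finite set $Y=\{y_1,\dots,y_N\}\subset\mathbb{R}^n$ of $N$ points, a cost $c:X\times Y\to\mathbb{R}$, and a probability measure $\mu=\rho\,dx$ with $\rho\in C^0(X)$, $\mathrm{spt}\,\mu\subset X$. $\mathcal{L}$ is Lebesgue measure; superscripts are coordinates; $\mathbf{1}=(1,\dots,1)\in\mathbb{R}^N$. Conditions on $c$: (Reg) $c(\cdot,y_i)\in C^2(X)$ for all $i$. (Twist) $\nabla_xc(x,y_i)\ne\nabla_xc(x,y_k)$ for all $x\in X$, $i\ne k$. (QC) for each $i$ there are a convex set $X_i\subset\mathbb{R}^n$ and a $C^2$ diffeomorphism $\exp^c_i:X_i\to X$ such that for all $t\in\mathbb{R}$ and all $1\le k,i\le N$ the set $\{p\in X_i:-c(\exp^c_i(p),y_k)+c(\exp^c_i(p),y_i)\le t\}$ is convex. A set $\tilde X\subset X$ is $c$-convex with respect to $Y$ if $(\exp^c_i)^{-1}(\tilde X)$ is convex for every $i$. $\psi^{c^*}(x)=\max_i(-c(x,y_i)-\psi^i)$, $\mathrm{Lag}_i(\psi)=\{x\in X:-c(x,y_i)-\psi^i=\psi^{c^*}(x)\}$. Hausdorff distance of nonempty sets: $d_{\mathcal{H}}(A,B)=\max(\sup_{x\in A}d(x,B),\sup_{x\in B}d(x,A))$. A positive finite constant is universal if it has bounds away from zero and infinity depending only on: $n$, $\|\rho\|_{C^0(X)}$, $\mathcal{H}^{n-1}(\partial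 X)$, $\max_i\|c(\cdot,y_i)\|_{C^2(X)}$, $\varepsilon_{\mathrm{tw}}=\min_{x\in X}\min_{i\ne j}\|\nabla_xc(x,y_i)-\nabla_xc(x,y_j)\|$, $C_\nabla=\max_{x\in X,i}\|\nabla_xc(x,y_i)\|$, $C_{\exp}=\max_i\max\{\|\exp^c_i\|_{C^{0,1}((\exp^c_i)^{-1}(X))},\|(\exp^c_i)^{-1}\|_{C^{0,1}(X)}\}$, $C_{\mathrm{cond}}=\max_i\max_{p\in(\exp^c_i)^{-1}(X)}\mathrm{cond}(D\exp^c_i(p))$ (condition number), $C_{\det}=\max_i\|\det(D\exp^c_i)\|_{C^{0,1}((\exp^c_i)^{-1}(X))}$. *)

(* Defs.v *)
From HB Require Import structures.
From mathcomp Require Import all_boot all_order all_algebra.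
From mathcomp Require Import all_classical all_reals all_analysis.

Set Implicit Arguments.
Unset Strict Implicit.
Unset Printing Implicit Defensive.

Import Order.TTheory GRing.Theory Num.Theory.
Import numFieldNormedType.Exports.

Local Open Scope classical_set_scope.
Local Open Scope ring_scope.

(* The library norm of 'rV[R]_n is the max norm: it is used only for the
   topology and for differentiability. All metric quantities use [enorm]. *)
Definition enorm {R : realType} {n : nat} (v : 'rV[R]_n) : R :=
  Num.sqrt (\sum_(i < n) v ord0 i ^+ 2).

Definition opnorm {R : realType} {n : nat} (M : 'M[R]_n) : R :=
  sup [set enorm (v *m M) | v in [set v : 'rV[R]_n | enorm v <= 1]].

Definition cond {R : realType} {n : nat} (M : 'M[R]_n) : R :=
  opnorm M * opnorm (invmx M).

(* Countable covers by arbitrary sets, weighted by [tau]: [mu_ext] over the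
   sigma-algebra of all subsets. *)
Definition cover_outer {R : realType} {T : pointedType}
    (tau : set T -> \bar R) : set T -> \bar R :=
  @mu_ext _ (g_sigma_algebraType [set: set T]) R tau.

Definition box {R : realType} {n : nat} (a b : 'rV[R]_n) : set 'rV[R]_n :=
  [set x | forall i, a ord0 i < x ord0 i <= b ord0 i].

(* +oo on sets that are not boxes. *)
Definition box_volume {R : realType} {n : nat} (B : set 'rV[R]_n) : \bar R :=
  if B == set0 then 0%E else
  ereal_inf [set v | exists a b : 'rV[R]_n,
    [/\ forall i, a ord0 i <= b ord0 i, B = box a b
      & v = (\prod_(i < n) (b ord0 i - a ord0 i))%:E]].

(* Lebesgue (outer) measure on R^n; its restriction to the Caratheodory
   sigma-algebra is the measure used for integration. *)
Definition lebesgue_rV {R : realType} (n : nat) : set 'rV[R]_n -> \bar R :=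
  cover_outer box_volume.

Section lebesgue_rV_outer_measure.
Context {R : realType} {n : nat}.
Local Open Scope ereal_scope.

Let tau := @box_volume R n.

Let tau0 : tau set0 = 0.
Proof. by rewrite /tau /box_volume eqxx. Qed.

Let tau_ge0 B : 0 <= tau B.
Proof.
rewrite /tau /box_volume; case: ifP => // _.
apply: le_ereal_inf_tmp => _ [a [b [ab _ ->]]].
by rewrite lee_fin; apply: prodr_ge0 => i _; rewrite subr_ge0.
Qed.

Let D := g_sigma_algebraType [set: set 'rV[R]_n].

Lemma lebesgue_rV0 : lebesgue_rV (set0 : set 'rV[R]_n) = 0.
Proof. exact: (@mu_ext0 _ D R tau tau0 tau_ge0). Qed.

Lemma lebesgue_rV_ge0 (A : set 'rV[R]_n) : 0 <= lebesgue_rV A.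
Proof. exact: (@mu_ext_ge0 _ D R tau tau_ge0). Qed.

Lemma le_lebesgue_rV :
  {homo @lebesgue_rV R n : A B / A `<=` B >-> A <= B}.
Proof. exact: (@le_mu_ext _ D R tau). Qed.

Lemma lebesgue_rV_sigma_subadditive : sigma_subadditive (@lebesgue_rV R n).
Proof. exact: (@mu_ext_sigma_subadditive _ D R tau tau_ge0). Qed.

HB.instance Definition _ :=
  isOuterMeasure.Build R 'rV[R]_n (@lebesgue_rV R n)
    lebesgue_rV0 lebesgue_rV_ge0 le_lebesgue_rV lebesgue_rV_sigma_subadditive.

End lebesgue_rV_outer_measure.

Definition lebesgue_measure_rV {R : realType} (n : nat) :=
  let mu := (@lebesgue_rV R n : {outer_measure set 'rV[R]_n -> \bar R}) in
  (mu : set (caratheodory_type mu) -> \bar R)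
    : {measure set (caratheodory_type mu) -> \bar R}.

Definition integral_rV {R : realType} {n : nat}
    (A : set 'rV[R]_n) (f : 'rV[R]_n -> R) : \bar R :=
  (\int[@lebesgue_measure_rV R n]_(x in A) (f x)%:E)%E.

Definition ball_volume (R : realType) (m : nat) : \bar R :=
  lebesgue_rV [set v : 'rV[R]_m | enorm v <= 1].

Definition ediam {R : realType} {n : nat} (B : set 'rV[R]_n) : \bar R :=
  ereal_sup [set (enorm (p.1 - p.2))%:E | p in B `*` B].

Definition hausdorff_premeasure {R : realType} {n : nat} (m : nat) (delta : R)
    (B : set 'rV[R]_n) : \bar R :=
  if B == set0 then 0%E
  else if (ediam B <= delta%:E)%E
  then (ball_volume R m * ((fine (ediam B) / 2) ^+ m)%:E)%E
  else +oo%E.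

Definition hausdorff_measure {R : realType} {n : nat} (m : nat)
    (A : set 'rV[R]_n) : \bar R :=
  ereal_sup [set cover_outer (hausdorff_premeasure m delta) A
            | delta in [set delta : R | 0 < delta]].

Definition bdry {T : topologicalType} (A : set T) : set T :=
  closure A `\` interior A.

(* Near each boundary point, A is the closed region on one side of the graph,
   over the hyperplane orthogonal to a unit vector nu, of a Lipschitz
   function g; x - <x, nu> nu is the projection of x to that hyperplane. *)
Definition lipschitz_boundary {R : realType} {n : nat} (A : set 'rV[R]_n) :
    Prop :=
  forall x0, bdry A x0 ->
  exists (nu : 'rV[R]_n) (g : 'rV[R]_n -> R) (K r : R),
    [/\ enorm nu = 1, 0 < r,
        forall u v, `|g u - g v| <= K * enorm (u - v)
      & forall x, enorm (x - x0) < r ->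
          let h := \sum_(i < n) x ord0 i * nu ord0 i in
          A x <-> h <= g (x - h *: nu)].

Section C2.
Context {R : realType} {n : nat} {V : normedModType R}.
Implicit Types (A U : set 'rV[R]_n) (f g : 'rV[R]_n -> V).

Definition C1_open U f : Prop := forall x, U x ->
  differentiable f x /\
  forall j : 'I_n, {for x, continuous (fun z => 'D_(delta_mx ord0 j) f z)}.

Definition C2_open U f : Prop :=
  C1_open U f /\
  forall j : 'I_n, C1_open U (fun z => 'D_(delta_mx ord0 j) f z).

Definition C2_extension A f g : Prop := exists U,
  [/\ open U, A `<=` U, C2_open U g & forall x, A x -> g x = f x].

(* C^2 up to the boundary of a closed set A; values of f outside A are
   irrelevant. *)
Definition C2_on A f : Prop := exists g, C2_extension A f g.

(* Derivatives on A are those of an extension. When A is contained in the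
   closure of its interior they do not depend on which one is picked. *)
Definition C2_ext A f : 'rV[R]_n -> V := xget f (C2_extension A f).

End C2.

Definition grad {R : realType} {n : nat} (f : 'rV[R]_n -> R) (x : 'rV[R]_n) :
    'rV[R]_n :=
  \row_(j < n) 'D_(delta_mx ord0 j) (f : 'rV[R]_n -> R^o) x.

Definition grad_on {R : realType} {n : nat} (A : set 'rV[R]_n)
    (f : 'rV[R]_n -> R) : 'rV[R]_n -> 'rV[R]_n :=
  grad (C2_ext A (f : 'rV[R]_n -> R^o)).

Definition hess_on {R : realType} {n : nat} (A : set 'rV[R]_n)
    (f : 'rV[R]_n -> R) (x : 'rV[R]_n) : 'M[R]_n :=
  'J (grad_on A f) x.

(* [jacobian] acts on row vectors on the right, i.e. it is the transpose of the
   usual matrix; the condition number and determinant are unaffected. *)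
Definition jac_on {R : realType} {n : nat} (A : set 'rV[R]_n)
    (f : 'rV[R]_n -> 'rV[R]_n) (x : 'rV[R]_n) : 'M[R]_n :=
  'J (C2_ext A f) x.

Definition supnorm {R : realType} {T V : Type} (nrm : V -> R)
    (A : set T) (f : T -> V) : \bar R :=
  ereal_sup [set (nrm (f x))%:E | x in A].

Definition C0norm {R : realType} {T : Type} (A : set T) (f : T -> R) : \bar R :=
  supnorm Num.norm A f.

Definition C2norm {R : realType} {n : nat} (A : set 'rV[R]_n)
    (f : 'rV[R]_n -> R) : \bar R :=
  (C0norm A f + supnorm enorm A (grad_on A f)
   + supnorm opnorm A (hess_on A f))%E.

(* Pairs x = y contribute 0 / 0 = 0. *)
Definition C01norm {R : realType} {n : nat} {V : zmodType} (nrm : V -> R)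
    (A : set 'rV[R]_n) (f : 'rV[R]_n -> V) : \bar R :=
  (supnorm nrm A f
   + ereal_sup [set (nrm (f p.1 - f p.2) / enorm (p.1 - p.2))%:E
               | p in A `*` A])%E.

(* rho dx restricted to X is a probability measure, rho continuous on X. *)
Definition continuous_density {R : realType} {n : nat} (X : set 'rV[R]_n)
    (rho : 'rV[R]_n -> R) : Prop :=
  [/\ {within X, continuous rho}, forall x, X x -> 0 <= rho x
    & integral_rV X rho = 1%E].

Section costs.
Context {R : realType} {n N : nat}.
Variables (X : set 'rV[R]_n) (y : 'I_N -> 'rV[R]_n)
  (c : 'rV[R]_n -> 'rV[R]_n -> R).

Definition Reg : Prop :=
  forall i, C2_on X ((fun x => c x (y i)) : 'rV[R]_n -> R^o).

Definition grad_cost (i : 'I_N) : 'rV[R]_n -> 'rV[R]_n :=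
  grad_on X (fun x => c x (y i)).

Definition Twist : Prop :=
  forall x, X x -> forall i k, i != k -> grad_cost i x <> grad_cost k x.

(* E : P -> X with inverse L : X -> P. In [QC], [P i], [E i] and [L i] are X_i,
   exp^c_i and its inverse. *)
Definition C2_diffeo (P : set 'rV[R]_n) (E L : 'rV[R]_n -> 'rV[R]_n) : Prop :=
  [/\ forall p, P p -> X (E p) /\ L (E p) = p,
      forall x, X x -> P (L x) /\ E (L x) = x,
      C2_on P E & C2_on X L].

Definition QC (P : 'I_N -> set 'rV[R]_n) (E L : 'I_N -> 'rV[R]_n -> 'rV[R]_n) :
    Prop :=
  forall i, [/\ convex_set (P i), C2_diffeo (P i) (E i) (L i)
    & forall (t : R) (k : 'I_N),
        convex_set [set p | P i p /\ - c (E i p) (y k) + c (E i p) (y i) <= t]].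

Definition c_convex (P : 'I_N -> set 'rV[R]_n)
    (E : 'I_N -> 'rV[R]_n -> 'rV[R]_n) (A : set 'rV[R]_n) : Prop :=
  forall i, convex_set [set p | P i p /\ A (E i p)].

Definition c_transform (psi : 'rV[R]_N) (x : 'rV[R]_n) : R :=
  sup [set - c x (y i) - psi ord0 i | i in [set: 'I_N]].

Definition Lag (psi : 'rV[R]_N) (i : 'I_N) : set 'rV[R]_n :=
  [set x | X x /\ - c x (y i) - psi ord0 i = c_transform psi x].

Definition min_lag_volume (psi : 'rV[R]_N) : \bar R :=
  ereal_inf [set lebesgue_rV (Lag psi i) | i in [set: 'I_N]].

Definition cost_C2norm : \bar R :=
  ereal_sup [set C2norm X (fun x => c x (y i)) | i in [set: 'I_N]].

(* +oo when N = 1. *)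
Definition eps_tw : \bar R :=
  ereal_inf [set v | exists x i k,
    [/\ X x, i != k & v = (enorm (grad_cost i x - grad_cost k x))%:E]].

Definition C_nabla : \bar R :=
  ereal_sup [set supnorm enorm X (grad_cost i) | i in [set: 'I_N]].

End costs.

Section exponentials.
Context {R : realType} {n N : nat}.
Variables (X : set 'rV[R]_n) (P : 'I_N -> set 'rV[R]_n)
  (E L : 'I_N -> 'rV[R]_n -> 'rV[R]_n).

(* The preimage of X under exp^c_i is its whole domain [P i]. *)
Definition C_exp : \bar R :=
  ereal_sup [set maxe (C01norm enorm (P i) (E i)) (C01norm enorm X (L i))
            | i in [set: 'I_N]].

Definition C_cond : \bar R :=
  ereal_sup [set supnorm cond (P i) (jac_on (P i) (E i)) | i in [set: 'I_N]].

Definition C_det : \bar R :=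
  ereal_sup [set C01norm Num.norm (P i) (fun p => \det (jac_on (P i) (E i) p))
            | i in [set: 'I_N]].

End exponentials.

Definition dist_set {R : realType} {n : nat} (x : 'rV[R]_n)
    (B : set 'rV[R]_n) : R :=
  inf [set enorm (x - z) | z in B].

Definition hausdorff_dist {R : realType} {n : nat} (A B : set 'rV[R]_n) : R :=
  Num.max (sup [set dist_set x B | x in A]) (sup [set dist_set x A | x in B]).

(* Main.v *)
Require Import Defs.
From HB Require Import structures.
From mathcomp Require Import all_boot all_order all_algebra.
From mathcomp Require Import all_classical all_reals all_analysis.
From mathcomp Require Import ring lra.

Set Implicit Arguments.
Unset Strict Implicit.
Unset Printing Implicit Defensive.

Import Order.TTheory GRing.Theory Num.Theory.
Import numFieldNormedType.Exports.

Local Open Scope classical_set_scope.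
Local Open Scope ring_scope.

(** Put [d i := psi1 i - psi2 i]. Two c-transforms differ by at most
[max_i |d i|], and [d] has zero sum, so it is enough to bound the oscillation
[max_{i,k} |d i - d k|].

Suppose that the cells of [psi1] with indices [i] and [k] have a common point
[x]. There [c x (y i) + psi1 i = c x (y k) + psi1 k]. The cell [i] of [psi2]
has a point [z] within about [h_i] of [x], where [h_i] is the Hausdorff
distance between the two cells of index [i], and there
[c z (y i) + psi2 i <= c z (y k) + psi2 k]. If the costs are [K]-Lipschitz on
[X], subtracting gives [d k - d i <= 2 K h_i] ([potential_gap_le]), and
exchanging [i] and [k] gives [|d i - d k| <= 2 K max(h_i, h_k)]. Now [X] is
connected, being the image of a convex set under an exponential map, and it is
covered by the finitely many closed nonempty cells of [psi1]; hence the graph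
of touching cells is connected. Following a simple path in that graph,
[|d i - d k| <= N 2 K S] for all [i] and [k], with [S] the square root of the
sum of the [h_i ^ 2] ([adjacency_oscillation]).

The Lipschitz constant [K = C_nabla C_exp^2] is universal ([cost_lipschitz]): a
segment in the convex domain of an exponential map is sent to a curve in [X]
whose length is at most [C_exp^2] times the distance of its ends. The
denominator costs only a constant: [X] lies in the ball of radius [C_exp], so
the volume [m] of a cell is at most [V = (2 (C_exp + 1))^n], and
[1 <= V^(1 - 1/n) / m^(1 - 1/n)].

The constant has to be chosen from the values of [C_nabla] and [C_exp] as
extended reals, hence the need to know that they are not [+oo]
([C_nabla_lty], [C_exp_lty]). This is where compactness of [X] and the [C^2]
regularity enter: a [C^1] map on a neighbourhood of a compact set is Lipschitz
on that set, convex or not ([C1_lipschitz_compact]). *)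

(** * The Euclidean norm *)

Section euclidean_norm.
Context {R : realType} {n : nat}.
Implicit Types u v w : 'rV[R]_n.

Lemma enorm_ge0 v : 0 <= enorm v.
Proof. exact: sqrtr_ge0. Qed.

Lemma sqr_enorm v : enorm v ^+ 2 = \sum_(i < n) v ord0 i ^+ 2.
Proof. by rewrite sqr_sqrtr// sumr_ge0// => i _; exact: sqr_ge0. Qed.

Lemma enormZ a v : enorm (a *: v) = `|a| * enorm v.
Proof.
rewrite /enorm; under eq_bigr do rewrite mxE exprMn.
by rewrite -mulr_sumr sqrtrM ?sqr_ge0// sqrtr_sqr.
Qed.

Lemma enorm0 : enorm (0 : 'rV[R]_n) = 0.
Proof. by rewrite -(scale0r 0) enormZ normr0 mul0r. Qed.

Lemma enormN v : enorm (- v) = enorm v.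
Proof. by rewrite -scaleN1r enormZ normrN1 mul1r. Qed.

Lemma coord_le_enorm v i : `|v ord0 i| <= enorm v.
Proof.
rewrite -sqrtr_sqr ler_sqrt ?sumr_ge0// => [|k _]; last exact: sqr_ge0.
by rewrite (bigD1 i)//= lerDl sumr_ge0// => k _; exact: sqr_ge0.
Qed.

Lemma enorm_eq0 v : enorm v = 0 -> v = 0.
Proof.
move=> v0; apply/rowP => i; rewrite mxE; apply/eqP.
by rewrite -normr_le0 -v0 coord_le_enorm.
Qed.

Lemma cauchy_schwarz u v :
  \sum_(i < n) u ord0 i * v ord0 i <= enorm u * enorm v.
Proof.
have [/enorm_eq0 ->|u0] := eqVneq (enorm u) 0.
  by rewrite enorm0 mul0r big1// => i _; rewrite mxE mul0r.
have [/enorm_eq0 ->|v0] := eqVneq (enorm v) 0.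
  by rewrite enorm0 mulr0 big1// => i _; rewrite mxE mulr0.
have : 0 < enorm u by rewrite lt_def u0 enorm_ge0.
have : 0 < enorm v by rewrite lt_def v0 enorm_ge0.
move: (sqr_enorm u) (sqr_enorm v); set a := enorm u; set b := enorm v.
move=> ua vb b_gt0 a_gt0.
(* Expand the square of the norm of [b *: u - a *: v], where [a] and [b] are
   the norms of [u] and [v]. *)
have : 0 <= \sum_(i < n) (b * u ord0 i - a * v ord0 i) ^+ 2.
  by apply: sumr_ge0 => i _; exact: sqr_ge0.
have -> : \sum_(i < n) (b * u ord0 i - a * v ord0 i) ^+ 2 =
    2 * (a * b) * (a * b - \sum_(i < n) u ord0 i * v ord0 i).
  rewrite (eq_bigr (fun i => b ^+ 2 * u ord0 i ^+ 2 + a ^+ 2 * v ord0 i ^+ 2 -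
    2 * (a * b) * (u ord0 i * v ord0 i))); last by move=> i _; ring.
  by rewrite sumrB big_split/= -!mulr_sumr -ua -vb; ring.
by rewrite pmulr_rge0 ?subr_ge0// mulr_gt0// mulr_gt0.
Qed.

Lemma ler_enormD u v : enorm (u + v) <= enorm u + enorm v.
Proof.
rewrite -(@ler_pXn2r _ 2) ?nnegrE ?addr_ge0 ?enorm_ge0// sqr_enorm.
rewrite (eq_bigr (fun i => u ord0 i ^+ 2 + v ord0 i ^+ 2 +
  2 * (u ord0 i * v ord0 i))); last by move=> i _; rewrite mxE; ring.
rewrite !big_split/= -mulr_sumr -!sqr_enorm.
have := cauchy_schwarz u v; nra.
Qed.

Lemma coord_le_norm v i : `|v ord0 i| <= `|v|.
Proof.
rewrite [leRHS]/Num.Def.normr/= mx_normrE.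
exact: (le_bigmax _ (fun ij => `|v ij.1 ij.2|) (ord0, i)).
Qed.

Lemma enorm_le_sum v : enorm v <= \sum_(i < n) `|v ord0 i|.
Proof.
have s0 : 0 <= \sum_(i < n) `|v ord0 i| by apply: sumr_ge0.
rewrite -(@ler_pXn2r _ 2) ?nnegrE ?enorm_ge0// sqr_enorm [leRHS]expr2 mulr_suml.
apply: ler_sum => i _; rewrite -real_normK ?num_real// expr2.
by rewrite ler_wpM2l// (bigD1 i)//= lerDl sumr_ge0.
Qed.

Lemma enorm_le_norm v : enorm v <= n%:R * `|v|.
Proof.
apply: le_trans (enorm_le_sum v) _; rewrite mulr_natl -[X in _ *+ X]card_ord.
by rewrite -sumr_const; apply: ler_sum => i _; exact: coord_le_norm.
Qed.

Lemma enorm_continuous : continuous (@enorm R n).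
Proof.
move=> v; apply: continuous_comp; last exact: sqrt_continuous.
apply: cvg_big => [||i _]; [exact: add_continuous|exact: (@nbhs_filter _ v)|].
apply: (@continuous_comp _ _ _ (fun w : 'rV[R]_n => w ord0 i) (@GRing.exp R ^~ 2)).
  exact: coord_continuous.
exact: exprn_continuous.
Qed.

End euclidean_norm.

(** * Mean value inequalities *)

Lemma convex_segment (R : realType) (n : nat) (P : set 'rV[R]_n)
    (p q : 'rV[R]_n) (t : R) :
  convex_set P -> P p -> P q -> 0 <= t <= 1 -> P (p + t *: (q - p)).
Proof.
move=> cP Pp Pq t01.
have /andP[t0 t1] := t01.
have t01' : Itv.spec (@Itv.num_sem R) (Itv.Real `[0%Z, 1%Z]) t.
  by rewrite /= /Itv.num_sem/= num_real/= in_itv/= t01.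
have := cP q p (Itv.mk t01'); rewrite !inE => /(_ Pq Pp).
congr P; rewrite /conv/= scalerBl scale1r scalerBr.
by rewrite addrC -addrA; congr (_ + _); rewrite addrC.
Qed.

Section differential.
Context {R : realType} {n : nat}.

Lemma diff_sum_partials (W : normedModType R) (f : 'rV[R]_n -> W)
    (x v : 'rV[R]_n) : differentiable f x ->
  'd f x v = \sum_(j < n) v ord0 j *: 'D_(delta_mx ord0 j) f x.
Proof.
move=> df; rewrite {1}(row_sum_delta v) linear_sum/=.
by apply: eq_bigr => j _; rewrite linearZ/= deriveE.
Qed.

Lemma norm_diff_le_grad (f : 'rV[R]_n -> R^o) (x v : 'rV[R]_n) :
  differentiable f x -> `|'d f x v| <= enorm (grad f x) * enorm v.
Proof.
move=> df; have le u : 'd f x u <= enorm (grad f x) * enorm u.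
  rewrite diff_sum_partials// mulrC (le_trans _ (cauchy_schwarz _ _))//.
  by apply: ler_sum => j _; rewrite mxE.
by rewrite ler_norml le andbT lerNl -linearN -(enormN v) le.
Qed.

Lemma curve_mean_value (f : 'rV[R]_n -> R^o) (g : R -> 'rV[R]_n) (M : R) :
  (forall t : R, 0 <= t <= 1 -> differentiable g t /\ differentiable f (g t)) ->
  (forall t : R, 0 < t < 1 -> `|'d f (g t) ('D_1 g t)| <= M) ->
  `|f (g 1) - f (g 0)| <= M.
Proof.
move=> dfg le_M.
have dcomp (t : R) : 0 <= t <= 1 -> differentiable (f \o g) t.
  by move=> /dfg[dg df]; exact: differentiable_comp.
have [||t] := @MVT R (f \o g) ('D_1 (f \o g)) 0 1 ltr01.
- move=> t /itvP t01; apply: DeriveDef => //.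
  by apply: diff_derivable; apply: dcomp; rewrite !t01.
- apply: continuous_in_subspaceT => t; rewrite inE/= in_itv/= => t01.
  by apply: differentiable_continuous; exact: dcomp.
rewrite in_itv/= => t01; rewrite subr0 mulr1 => /= ->.
have t01' : 0 <= t <= 1 by case/andP: t01 => /ltW -> /ltW ->.
have [dg df] := dfg t t01'.
rewrite deriveE; last exact: dcomp.
rewrite diff_comp//=.
have <- : 'D_1 g t = 'd g t 1 by exact: deriveE.
exact: le_M.
Qed.

Lemma derive_segment (p v : 'rV[R]_n) (t : R) :
  differentiable (fun s : R => p + s *: v) t /\
  'D_1 (fun s : R => p + s *: v) t = v.
Proof.
have H : is_diff t (cst p + *:%R ^~ v) (0 + *:%R ^~ v) by exact: is_diffD.
have dH : differentiable (cst p + *:%R ^~ v) t by exact: ex_diff.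
by split=> //; rewrite deriveE// diff_val add0r scale1r.
Qed.

(** The derivative of [E] along a segment of [P] is a limit of difference
quotients of [E] between points of [P], so the Lipschitz constant of [E] on [P]
bounds it in the Euclidean norm. *)
Lemma lipschitz_along_convex (P X : set 'rV[R]_n) (E : 'rV[R]_n -> 'rV[R]_n)
    (f : 'rV[R]_n -> R^o) (a b : R) :
  convex_set P -> (forall p, P p -> X (E p)) ->
  (forall p, P p -> differentiable E p) ->
  (forall x, X x -> differentiable f x) ->
  (forall x, X x -> enorm (grad f x) <= a) ->
  (forall p q, P p -> P q -> enorm (E p - E q) <= b * enorm (p - q)) ->
  forall p q, P p -> P q -> `|f (E q) - f (E p)| <= a * (b * enorm (q - p)).
Proof.
move=> cP PX dE df fa Eb p q Pp Pq.
pose v : 'rV[R]_n := q - p; pose s (t : R) : 'rV[R]_n := p + t *: v.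
have Ps (t : R) : 0 <= t <= 1 -> P (s t) by exact: convex_segment.
have ds (t : R) : differentiable s t by have [] := derive_segment p v t.
have dEs (t : R) : 0 <= t <= 1 -> differentiable (E \o s) t.
  by move=> t01; apply: differentiable_comp => //; exact/dE/Ps.
have -> : E q = (E \o s) 1 by rewrite /= /s scale1r addrC subrK.
have -> : E p = (E \o s) 0 by rewrite /= /s scale0r addr0.
apply: curve_mean_value => [t t01|t t01].
  by split; [exact: dEs | exact/df/PX/Ps].
have t01' : 0 <= t <= 1 by case/andP: t01 => /ltW -> /ltW ->.
have Xt : X ((E \o s) t) by exact/PX/Ps.
apply: le_trans (norm_diff_le_grad _ (df _ Xt)) _.
apply: ler_pM; rewrite ?enorm_ge0//; first exact: fa.
have dq : derivable (E \o s) t 1 by exact/diff_derivable/dEs.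
have cq : enorm (h^-1 *: ((E \o s) (h *: 1 + t) - (E \o s) t)) @[h --> 0^'] -->
    enorm ('D_1 (E \o s) t).
  by apply: continuous_cvg; [exact: enorm_continuous|exact: dq].
apply: (cvgr_to_le cq).
near=> h.
have h0 : h != 0 by near: h; exact: nbhs_dnbhs_neq.
have t01h : 0 <= h + t <= 1.
  have : `|h| < Num.min t (1 - t).
    by near: h; apply: dnbhs0_lt; rewrite lt_min subr_gt0.
  by rewrite lt_min => /andP[]; rewrite !ltr_norml; lra.
rewrite enormZ /= [h%:A]mulr1.
apply: le_trans (ler_wpM2l (normr_ge0 _) (Eb _ _ (Ps _ t01h) (Ps _ t01'))) _.
have -> : s (h + t) - s t = h *: v.
  by rewrite /s opprD addrACA subrr add0r -scalerBl addrK.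
by rewrite enormZ normfV [b * _]mulrCA mulKf ?normr_eq0.
Unshelve. all: by end_near.
Qed.

End differential.

(** * Uniform bounds on compact sets *)

Section compactness.
Local Open Scope convex_scope.
Context {R : realType}.

(** The abstract form of the principle that local bounds on a compact set give
a global one; [Q M x] reads as an inequality at [x] with constant [M]. *)
Lemma compact_uniform_bound (T : topologicalType) (K : set T)
    (Q : R -> T -> Prop) :
  (forall M M' x, M <= M' -> Q M x -> Q M' x) -> compact K ->
  (forall x, K x -> exists M, \forall x' \near x, K x' -> Q M x') ->
  exists M, forall x, K x -> Q M x.
Proof.
move=> Qmono /compact_near_coveringP/near_covering_withinP cK Qloc.
have : \forall M \near +oo, K `<=` Q M.
  apply: cK => x Kx; have [M QM] := Qloc x Kx.
  exists ([set x' | K x' -> Q M x'], [set M' | M <= M']) => /=.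
    by split=> //; exact/nbhs_pinfty_ge/num_real.
  by move=> [x' M'] /= [QM' MM'] /QM'; exact: Qmono.
by move=> /pinfty_ex_gt0[M _ QM]; exists M.
Qed.

Lemma near_le_norm (T : topologicalType) (V : normedModType R) (f : T -> V)
    (x : T) : {for x, continuous f} -> \forall y \near x, `|f y| <= `|f x| + 1.
Proof.
move=> /cvgrPdist_le/(_ 1 ltr01); apply: filterS => y fy.
by rewrite -lerBlDl (le_trans (lerB_dist _ _))// distrC.
Qed.

Lemma near_partials_le (n : nat) (V : normedModType R) (f : 'rV[R]_n -> V)
    (x : 'rV[R]_n) :
  (forall j : 'I_n, {for x, continuous (fun z => 'D_(delta_mx ord0 j) f z)}) ->
  \forall z \near x, forall j : 'I_n,
    `|'D_(delta_mx ord0 j) f z| <= `|'D_(delta_mx ord0 j) f x| + 1.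
Proof.
move=> cD.
apply: (@filter_forall _ _ (fun (j : 'I_n) z =>
  `|'D_(delta_mx ord0 j) f z| <= `|'D_(delta_mx ord0 j) f x| + 1) _
  (@nbhs_filter _ x)) => j.
exact: (near_le_norm (cD j)).
Qed.

Lemma convex_ball_rV (n : nat) (x : 'rV[R]_n) (r : R) :
  convex_set (ball x r : set 'rV[R]_n).
Proof.
move=> p q t; rewrite !inE -!ball_normE /ball_/= => xp xq.
have t0 : 0 <= t%:num by [].
have t1 : t%:num <= 1 by [].
have -> : x - p <| t |> q = t%:num *: (x - p) + (1 - t%:num) *: (x - q).
  rewrite /conv/= !scalerBr addrACA -scalerDl subrKC scale1r.
  by rewrite opprD.
rewrite (le_lt_trans (ler_normD _ _))// !normrZ !ger0_norm ?subr_ge0//.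
move: (t%:num) t0 t1 (`|x - p|) (`|x - q|) xp xq => s s0 s1 u v ur vr.
apply: (@le_lt_trans _ _ (Num.max u v)); last by rewrite gt_max ur.
have : u <= Num.max u v by rewrite le_max lexx.
have : v <= Num.max u v by rewrite le_max lexx orbT.
by move: (Num.max u v) => w; nra.
Qed.

(** On a small ball, which is convex, the mean value inequality applies to each
coordinate of [g]; the factor [n] comes from adding the coordinates up. *)
Lemma C1_locally_lipschitz (n : nat) (U : set 'rV[R]_n)
    (g : 'rV[R]_n -> 'rV[R]_n) (x : 'rV[R]_n) :
  open U -> C1_open U g -> U x ->
  exists M, \forall z \near (x, x),
    enorm (g z.1 - g z.2) <= M * enorm (z.1 - z.2).
Proof.
move=> oU gU Ux.
pose D (j : 'I_n) z := 'D_(delta_mx ord0 j) g z.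
pose a := \sum_(j < n) (`|D j x| + 1).
have nearD := near_partials_le (gU x Ux).2.
have [r r0 rU] : exists2 r : R, 0 < r &
    ball x r `<=` [set z | U z /\ forall j, `|D j z| <= `|D j x| + 1].
  by apply/nbhs_ballP; apply: filterI => //; exact: open_nbhs_nbhs.
pose gj j : 'rV[R]_n -> R^o := fun z => g z ord0 j.
have dgj j z : ball x r z -> differentiable (gj j) z.
  move=> /rU[/gU[dg _] _].
  exact: (differentiable_comp dg (differentiable_coord _ _ _)).
have gradgj j z : ball x r z -> enorm (grad (gj j) z) <= a.
  move=> /[dup] xz /rU[/gU[dg _] Dz].
  apply: le_trans (enorm_le_sum _) _; apply: ler_sum => k _.
  rewrite mxE; apply: le_trans (Dz k).
  have -> : 'D_(delta_mx ord0 k) (gj j) z = D k z ord0 j.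
    by rewrite /D derive_mx ?mxE//; exact: diff_derivable.
  exact: coord_le_norm.
exists (n%:R * a).
exists (ball x r, ball x r); first by split; exact: nbhsx_ballx.
move=> [q p] /= [xq xp]; rewrite (le_trans (enorm_le_sum _))//.
rewrite -mulrA mulr_natl -[X in _ *+ X]card_ord -sumr_const.
apply: ler_sum => j _; rewrite !mxE -[enorm _]mul1r.
apply: (@lipschitz_along_convex _ _ (ball x r) (ball x r) id (gj j)) => //.
- exact: convex_ball_rV.
- exact: dgj.
- exact: gradgj.
- by move=> u v _ _; rewrite mul1r.
Qed.

(** [K] is not assumed convex, so the mean value inequality does not apply
directly. The difference quotient is instead bounded near each point of
[K `*` K]: near the diagonal because [g] is locally Lipschitz, and away from it
because [g] is bounded and the denominator is not small. *)
Lemma C1_lipschitz_compact (n : nat) (U K : set 'rV[R]_n)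
    (g : 'rV[R]_n -> 'rV[R]_n) :
  open U -> C1_open U g -> K `<=` U -> compact K ->
  exists M, forall x y, K x -> K y ->
    enorm (g x) <= M /\ enorm (g x - g y) <= M * enorm (x - y).
Proof.
move=> oU gU KU cK.
have [B gB] : exists B, forall x, K x -> enorm (g x) <= B.
  apply: compact_uniform_bound => // [M M' x MM' /le_trans|x Kx]; first exact.
  have cg : {for x, continuous g}.
    by apply: differentiable_continuous; have [] := gU x (KU _ Kx).
  exists (n%:R * (`|g x| + 1)).
  apply: filterS (near_le_norm cg) => y gy _.
  by rewrite (le_trans (enorm_le_norm _))// ler_wpM2l.
have [M gM] : exists M, forall z, (K `*` K) z ->
    enorm (g z.1 - g z.2) <= M * enorm (z.1 - z.2).
  apply: compact_uniform_bound; last 2 first.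
  - exact: compact_setX.
  - move=> [x y] [/= Kx Ky]; have [<-|xy] := eqVneq x y.
      have [M HM] := C1_locally_lipschitz oU gU (KU _ Kx).
      by exists M; apply: filterS HM.
    pose d := enorm (x - y) / 2.
    have xy0 : 0 < enorm (x - y).
      rewrite lt_def enorm_ge0 andbT.
      by apply: contra xy => /eqP/enorm_eq0/eqP; rewrite subr_eq0.
    have d0 : 0 < d by rewrite divr_gt0.
    have cxy : {for (x, y), continuous
        (fun z : 'rV[R]_n * 'rV[R]_n => enorm (z.1 - z.2))}.
      apply: continuous_comp; last exact: enorm_continuous.
      by apply: cvgB; [exact: cvg_fst|exact: cvg_snd].
    exists ((B + B) / d).
    have dxy : d < enorm (x - y) by rewrite /d; lra.
    move/cvgr_gt : cxy => /(_ _ dxy).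
    apply: filterS => -[x' y'] /= /ltW dxy' [/= Kx' Ky'].
    rewrite mulrAC ler_pdivlMr//.
    have gxy : enorm (g x' - g y') <= B + B.
      by rewrite (le_trans (ler_enormD _ _))// enormN lerD// gB.
    by rewrite ler_pM ?enorm_ge0// ltW.
  - by move=> M M' z MM' /le_trans; apply; rewrite ler_wpM2r// enorm_ge0.
exists (Num.max B M) => x y Kx Ky; split.
  by rewrite le_max gB.
rewrite (le_trans (gM (x, y) _))// ler_wpM2r ?enorm_ge0// le_max lexx orbT//.
Qed.

End compactness.

(** * Finiteness of the universal constants *)

Section constants.
Context {R : realType}.

Lemma C2_extP (n : nat) (V : normedModType R) (A : set 'rV[R]_n)
    (f : 'rV[R]_n -> V) : C2_on A f -> C2_extension A f (C2_ext A f).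
Proof. exact: xgetPex. Qed.

Lemma le_fineK (x : \bar R) : (x < +oo)%E -> (x <= (fine x)%:E)%E.
Proof. by case: x => [r| |]// _; rewrite leNye. Qed.

Lemma ereal_sup_ord_lty (N : nat) (F : 'I_N -> \bar R) :
  (forall i, F i < +oo)%E -> (ereal_sup [set F i | i in [set: 'I_N]] < +oo)%E.
Proof.
move=> F_fin; apply: (@le_lt_trans _ _ (\big[maxe/-oo%E]_(i < N) F i)).
  by apply: ge_ereal_sup => _ [i _ <-]; exact: le_bigmax.
by apply/bigmax_ltP; split.
Qed.

Lemma C01norm_lty (n : nat) (K : set 'rV[R]_n) (g : 'rV[R]_n -> 'rV[R]_n) :
  compact K -> C2_on K g -> (C01norm enorm K g < +oo)%E.
Proof.
move=> cK [h [U [oU KU [hU _] hg]]].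
have [M hM] := C1_lipschitz_compact oU hU KU cK.
have gM x y : K x -> K y ->
    enorm (g x) <= M /\ enorm (g x - g y) <= M * enorm (x - y).
  by move=> Kx Ky; rewrite -!hg//; exact: hM.
rewrite /C01norm; apply: (@le_lt_trans _ _ (M%:E + M%:E)%E); last first.
  by rewrite -EFinD ltry.
apply: leeD; apply: ge_ereal_sup.
  by move=> _ [x Kx <-]; rewrite lee_fin; have [] := gM x x Kx Kx.
move=> _ [[x y] [/= Kx Ky] <-]; rewrite lee_fin.
have [gx gxy] := gM x y Kx Ky.
have M0 : 0 <= M by exact: le_trans (enorm_ge0 _) gx.
have [->|xy0] := eqVneq (enorm (x - y)) 0; first by rewrite invr0 mulr0.
by rewrite ler_pdivrMr// lt_def xy0 enorm_ge0.
Qed.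

(** Both terms of the norm are nonnegative as soon as the set has a point, the
second one because the pairs on the diagonal contribute [0]; hence each of them
is bounded by the sum. *)
Lemma le_C01norm (n : nat) (K : set 'rV[R]_n) (g : 'rV[R]_n -> 'rV[R]_n)
    (a : R) (x y : 'rV[R]_n) :
  (C01norm enorm K g <= a%:E)%E -> K x -> K y ->
  enorm (g x) <= a /\ enorm (g x - g y) <= a * enorm (x - y).
Proof.
rewrite /C01norm => le_a Kx Ky.
have ub1 z : K z -> ((enorm (g z))%:E <= supnorm enorm K g)%E.
  by move=> Kz; apply: ereal_sup_ubound; exists z.
have ub2 u v : K u -> K v -> ((enorm (g u - g v) / enorm (u - v))%:E <=
    ereal_sup [set (enorm (g p.1 - g p.2) / enorm (p.1 - p.2))%:E
              | p in K `*` K])%E.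
  by move=> Ku Kv; apply: ereal_sup_ubound; exists (u, v).
split; rewrite -lee_fin.
  apply: le_trans le_a; apply: le_trans (ub1 _ Kx) _; apply: leeDl.
  by apply: le_trans (ub2 x x Kx Kx); rewrite lee_fin divr_ge0 ?enorm_ge0.
have [/enorm_eq0/eqP|xy0] := eqVneq (enorm (x - y)) 0.
  by rewrite subr_eq0 => /eqP ->; rewrite !subrr enorm0 mulr0.
rewrite lee_fin -ler_pdivrMr ?lt_def ?xy0 ?enorm_ge0// -lee_fin.
apply: le_trans le_a; apply: le_trans (ub2 _ _ Kx Ky) _; apply: leeDr.
by apply: le_trans (ub1 x Kx); rewrite lee_fin enorm_ge0.
Qed.

(** The domain [P i] is the image of [X] under the continuous map [L i], hence
compact, which makes [E i] as well as [L i] a [C^2] map on a compact set. *)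
Lemma C_exp_lty (n N : nat) (X : set 'rV[R]_n) (y : 'I_N -> 'rV[R]_n)
    (c : 'rV[R]_n -> 'rV[R]_n -> R) (P : 'I_N -> set 'rV[R]_n)
    (E L : 'I_N -> 'rV[R]_n -> 'rV[R]_n) :
  compact X -> QC X y c P E L -> (C_exp X P E L < +oo)%E.
Proof.
move=> cX qc; apply: ereal_sup_ord_lty => i.
have [_ [PE XL E2 L2] _] := qc i.
rewrite gt_max !C01norm_lty//.
have -> : P i = L i @` X.
  apply/seteqP; split => [p /PE[XEp LEp]|_ [x /XL[PLx _] <-]//].
  by exists (E i p).
have [h [U [oU XU [hU _] hL]]] := L2.
have -> : L i @` X = h @` X.
  by apply/seteqP; split => _ [x Xx <-]; exists x => //; rewrite hL.
apply: continuous_compact => //.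
apply: continuous_in_subspaceT => x /[!inE] Xx.
by apply: differentiable_continuous; have [] := hU x (XU _ Xx).
Qed.

Lemma C_nabla_lty (n N : nat) (X : set 'rV[R]_n) (y : 'I_N -> 'rV[R]_n)
    (c : 'rV[R]_n -> 'rV[R]_n -> R) :
  compact X -> Reg X y c -> (C_nabla X y c < +oo)%E.
Proof.
move=> cX reg; apply: ereal_sup_ord_lty => i.
have := C2_extP (reg i); rewrite /grad_cost /grad_on.
move: (C2_ext X _) => f [U [oU XU [fU _] _]].
have [M fM] : exists M, forall x, X x -> enorm (grad f x) <= M.
  apply: compact_uniform_bound => // [M M' x MM' /le_trans|x Xx]; first exact.
  exists (\sum_(j < n) (`|'D_(delta_mx ord0 j) f x| + 1)).
  have nearD := near_partials_le (fU x (XU _ Xx)).2.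
  apply: filterS nearD => z Dz _; apply: le_trans (enorm_le_sum _) _.
  by apply: ler_sum => j _; rewrite mxE; exact: Dz.
apply: (@le_lt_trans _ _ M%:E); last by rewrite ltry.
by apply: ge_ereal_sup => _ [x Xx <-]; rewrite lee_fin; exact: fM.
Qed.

End constants.

(** * Chains of touching cells *)

Section adjacency.

Lemma convex_connected (R : realType) (n : nat) (P : set 'rV[R]_n) :
  convex_set P -> connected P.
Proof.
move=> cP; have [->|/set0P[p Pp]] := eqVneq P set0; first exact: connected0.
pose s (q : 'rV[R]_n) (t : R) : 'rV[R]_n := p + t *: (q - p).
have -> : P = \bigcup_(q in P) (s q @` `[0, 1]).
  apply/seteqP; split => [q Pq|_ [q Pq [t /= t01 <-]]].
    exists q => //; exists 1; first by rewrite /= in_itv/= ler01 lexx.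
    by rewrite /s scale1r addrC subrK.
  by apply: convex_segment => //; rewrite in_itv/= in t01.
apply: bigcup_connected => [|q Pq].
  exists p => q Pq; exists 0; first by rewrite /= in_itv/= ler01 lexx.
  by rewrite /s scale0r addr0.
apply: connected_continuous_connected; first exact: segment_connected.
apply: continuous_subspaceT => t; apply: differentiable_continuous.
by have [] := derive_segment p (q - p) t.
Qed.

(** The union of the cells that a chain of touching cells joins to [A i] is
closed; so is the union of the other ones, and no cell of the first kind meets
one of the second. As [X] is connected, the second kind is empty. A chain
without repetition has fewer than [N] steps, and [d] varies by at most [g]
along each. *)
Lemma adjacency_oscillation (R : realType) (T : topologicalType) (N : nat)
    (X : set T) (A : 'I_N -> set T) (d : 'I_N -> R) (g : R) :
  connected X -> X = \bigcup_i A i -> (forall i, closed (A i)) ->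
  (forall i, A i !=set0) -> 0 <= g ->
  (forall i k, A i `&` A k !=set0 -> `|d i - d k| <= g) ->
  forall i k, `|d i - d k| <= N%:R * g.
Proof.
move=> coX XA clA A0 g0 dg i k.
pose e : rel 'I_N := fun i k => `[< A i `&` A k !=set0 >].
have clU (S : pred 'I_N) : closed (\bigcup_(j in [set j | S j]) A j).
  by apply: closed_bigcup => //; exact: finite_finset.
have ik : connect e i k.
  pose B := \bigcup_(j in [set j | connect e i j]) A j.
  have BX : B `<=` X by rewrite XA => x [j _ Ajx]; exists j.
  have B_eq : B = X.
    apply: coX.
    - have [x Aix] := A0 i.
      by exists x, i => //=; exact: connect0.
    - exists (~` \bigcup_(j in [set j | ~~ connect e i j]) A j).
        by rewrite openC; exact: clU.
      apply/seteqP; split => [x Bx|x []].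
        split; first exact: BX.
        move=> [k' /= /negP ik' Ak'x]; apply: ik'.
        have [j /= ij Ajx] := Bx.
        apply: connect_trans ij _; apply: connect1; apply/asboolP.
        by exists x.
      rewrite XA => -[j _ Ajx] nx; exists j => //=; apply/negPn/negP => ij.
      by apply: nx; exists j.
    - exists B; first exact: clU.
      by apply/seteqP; split => [x Bx|x []//]; split => //; exact: BX.
  have [x Akx] := A0 k.
  have : B x by rewrite B_eq XA; exists k.
  move=> [j /= ij Ajx]; apply: connect_trans ij _; apply: connect1.
  by apply/asboolP; exists x.
have /connectP[p ep ->] := ik.
case/shortenP: ep => p' ep' up' _.
have szp' : (size p' <= N)%N.
  have := max_card (mem p'); rewrite card_ord; apply: leq_trans.
  by move: up' => /= /andP[_ /card_uniqP ->].
have : `|d i - d (last i p')| <= (size p')%:R * g.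
  elim: p' (i) ep' {up' szp'} => [|j p' IH] i0 /=.
    by rewrite subrr normr0 mul0r.
  move=> /andP[/asboolP/dg ej /IH le].
  rewrite -natr1 mulrDl mul1r [leRHS]addrC -(subrKA (d j)).
  by rewrite (le_trans (ler_normD _ _))// lerD.
by move=> /le_trans; apply; rewrite ler_wpM2r// ler_nat.
Qed.

(** Since the mean of [d] is zero, [N * d i] is the sum over [k] of
[d i - d k]. *)
Lemma norm_le_oscillation (R : realType) (N : nat) (d : 'I_N -> R) (M : R) :
  \sum_(i < N) d i = 0 -> (forall i k, `|d i - d k| <= M) ->
  forall i, `|d i| <= M.
Proof.
move=> d0 dM i.
have N0 : (0 : R) < N%:R by rewrite ltr0n (leq_ltn_trans _ (ltn_ord i)).
rewrite -(ler_pM2l N0) !mulr_natl -{1}[N]card_ord -normrMn -sumr_const.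
rewrite -[X in `|X|]subr0 -{2}d0 -sumrB (le_trans (ler_norm_sum _ _ _))//.
by rewrite -[X in _ *+ X]card_ord -sumr_const; apply: ler_sum.
Qed.

End adjacency.

(** * Volume of bounded sets *)

Section volume.
Context {R : realType} {n : nat}.

Lemma lebesgue_rV_box_le (a b : 'rV[R]_n) :
  (forall i, a ord0 i <= b ord0 i) ->
  (lebesgue_rV (box a b) <= (\prod_(i < n) (b ord0 i - a ord0 i))%:E)%E.
Proof.
move=> ab; pose B k := if k is 0%N then box a b else set0 : set 'rV[R]_n.
have bv0 : @box_volume R n set0 = 0%E by rewrite /box_volume eqxx.
have bvB : (box_volume (box a b) <= (\prod_(i < n) (b ord0 i - a ord0 i))%:E)%E.
  rewrite /box_volume; case: ifPn => _.
    by rewrite lee_fin prodr_ge0// => i _; rewrite subr_ge0.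
  by apply: ereal_inf_lbound; exists a, b.
apply: le_trans bvB; apply: ereal_inf_lbound; exists B.
  split=> [k|x xB]; first exact: sub_sigma_algebra.
  by exists 0%N.
apply: lim_near_cst => //; exists 1%N => // -[//|k _].
by rewrite /= big_nat_recl// big1 ?adde0// => j _; rewrite /= bv0.
Qed.

(** The set lies in the box of half-width [r + 1]; the radius is enlarged
because boxes are open at their lower faces. *)
Lemma lebesgue_rV_bounded_le (A : set 'rV[R]_n) (r : R) :
  0 <= r -> (forall x, A x -> enorm x <= r) ->
  (lebesgue_rV A <= ((2 * (r + 1)) ^+ n)%:E)%E.
Proof.
move=> r0 Ar.
have le_vol := @lebesgue_rV_box_le (const_mx (- (r + 1))) (const_mx (r + 1)).
apply: le_trans (le_trans (le_vol _) _).
- apply: le_lebesgue_rV => x /Ar xr i; rewrite !mxE.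
  have := le_trans (coord_le_enorm x i) xr.
  by rewrite ler_norml => /andP[? ?]; apply/andP; split; lra.
- by move=> i; rewrite !mxE; lra.
- rewrite lee_fin (eq_bigr (fun=> 2 * (r + 1))); last first.
    by move=> i _; rewrite !mxE; ring.
  by rewrite prodr_const card_ord.
Qed.

End volume.

(** * Laguerre cells *)

(** The bound on [A] makes the supremum in the definition of the Hausdorff
distance a genuine one: [sup] of an unbounded set of reals is [0]. *)
Lemma hausdorff_dist_near (R : realType) (n : nat) (A B : set 'rV[R]_n)
    (M e : R) (x : 'rV[R]_n) :
  (forall u, A u -> enorm u <= M) -> B !=set0 -> A x -> 0 < e ->
  exists2 z, B z & enorm (x - z) < hausdorff_dist A B + e.
Proof.
move=> AM B0 Ax e0.
have inf_B u : has_inf [set enorm (u - z) | z in B].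
  split; first by case: B0 => z Bz; exists (enorm (u - z)), z.
  by exists 0 => _ [z _ <-]; exact: enorm_ge0.
have [_ [z Bz <-] xz] := inf_adherent e0 (inf_B x).
exists z => //; apply: lt_le_trans xz _; rewrite lerD2r le_max; apply/orP; left.
apply: ub_le_sup; last by exists x.
have [z0 Bz0] := B0; exists (M + enorm z0) => _ [u Au <-].
apply: (@le_trans _ _ (enorm (u - z0))).
  by apply: ge_inf; [exact: (inf_B u).2 | exists z0].
by rewrite (le_trans (ler_enormD _ _))// enormN lerD2r AM.
Qed.

Section costs.
Context {R : realType} {n N : nat}.
Variables (X : set 'rV[R]_n) (y : 'I_N -> 'rV[R]_n)
  (c : 'rV[R]_n -> 'rV[R]_n -> R).

Lemma C_exp_ge (P : 'I_N -> set 'rV[R]_n) (E L : 'I_N -> 'rV[R]_n -> 'rV[R]_n)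
    (a : R) (i : 'I_N) : (C_exp X P E L <= a%:E)%E ->
  (C01norm enorm (P i) (E i) <= a%:E)%E /\ (C01norm enorm X (L i) <= a%:E)%E.
Proof.
move=> /(le_trans _) le_a; apply/andP; rewrite -ge_max.
by apply: le_a; rewrite /C_exp; apply: ereal_sup_ubound; exists i.
Qed.

(** [X] need not be convex, so two points of [X] are joined by the image under
[E i] of a segment of [P i]: one factor [b] comes from [L i], which gives the
ends of the segment, the other from [E i]. *)
Lemma cost_lipschitz (P : 'I_N -> set 'rV[R]_n)
    (E L : 'I_N -> 'rV[R]_n -> 'rV[R]_n) (a b : R) (i : 'I_N)
    (x z : 'rV[R]_n) :
  Reg X y c -> QC X y c P E L ->
  (C_nabla X y c <= a%:E)%E -> (C_exp X P E L <= b%:E)%E -> X x -> X z ->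
  `|c x (y i) - c z (y i)| <= a * (b * b) * enorm (x - z).
Proof.
move=> reg qc le_a le_b Xx Xz.
have [Pconv [PE XL [h [U [_ PU [hU _] hE]]] _] _] := qc i.
have [El Ll] := C_exp_ge i le_b.
have [PLx ELx] := XL x Xx; have [PLz ELz] := XL z Xz.
have grad_le u : X u -> enorm (grad_cost X y c i u) <= a.
  move=> Xu; rewrite -lee_fin; apply: le_trans le_a.
  apply: (@le_trans _ _ (supnorm enorm X (grad_cost X y c i))).
    by rewrite /supnorm; apply: ereal_sup_ubound; exists u.
  by rewrite /C_nabla; apply: ereal_sup_ubound; exists i.
have := C2_extP (reg i); move: grad_le; rewrite /grad_cost /grad_on.
move: (C2_ext X _) => f grad_le [V [_ XV [fV _] fc]].
have a0 : 0 <= a by exact: le_trans (enorm_ge0 _) (grad_le x Xx).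
have b0 : 0 <= b.
  have [+ _] := le_C01norm Ll Xx Xx; exact: le_trans (enorm_ge0 _).
have fE : `|f (h (L i x)) - f (h (L i z))| <=
    a * (b * enorm (L i x - L i z)).
  apply: (@lipschitz_along_convex _ _ (P i) X h f a b) => //.
  - by move=> p Pp; rewrite hE//; have [] := PE p Pp.
  - by move=> p /PU/hU[].
  - by move=> u /XV/fV[].
  - by move=> p q Pp Pq; rewrite !hE//; have [] := le_C01norm El Pp Pq.
move: fE; rewrite !hE// ELx ELz !fc// => /le_trans; apply.
rewrite -!mulrA !ler_wpM2l//.
by have [] := le_C01norm Ll Xx Xz.
Qed.

Lemma c_transform_attained (psi : 'rV[R]_N) (x : 'rV[R]_n) : (0 < N)%N ->
  exists i, c_transform y c psi x = - c x (y i) - psi ord0 i.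
Proof.
move=> N_gt0; pose F i := - c x (y i) - psi ord0 i.
have [i _ Fi] := @Order.TotalTheory.arg_maxP _ _ _ (Ordinal N_gt0) xpredT F isT.
exists i; apply/eqP; rewrite eq_le; apply/andP; split.
  apply: ge_sup; first by exists (F i), i.
  by move=> _ [k _ <-]; exact: Fi.
apply: ub_le_sup; last by exists i.
by exists (F i) => _ [k _ <-]; exact: Fi.
Qed.

Lemma c_transform_ge (psi : 'rV[R]_N) (x : 'rV[R]_n) (k : 'I_N) :
  - c x (y k) - psi ord0 k <= c_transform y c psi x.
Proof.
pose F i := - c x (y i) - psi ord0 i.
apply: ub_le_sup; last by exists k.
exists (\sum_i `|F i|) => _ [i _ <-].
by rewrite (bigD1 i)//= (le_trans (ler_norm _))// lerDl sumr_ge0.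
Qed.

Lemma c_transform_dist_le (psi1 psi2 : 'rV[R]_N) (M : R) (x : 'rV[R]_n) :
  (0 < N)%N -> (forall i, `|psi1 ord0 i - psi2 ord0 i| <= M) ->
  `|c_transform y c psi1 x - c_transform y c psi2 x| <= M.
Proof.
move=> N_gt0 psiM; rewrite ler_norml.
have [i ei] := c_transform_attained psi1 x N_gt0.
have [k ek] := c_transform_attained psi2 x N_gt0.
have := c_transform_ge psi2 x i; have := c_transform_ge psi1 x k.
have := psiM i; have := psiM k; rewrite ei ek !ler_norml.
by move=> /andP[? ?] /andP[? ?] ? ?; apply/andP; split; lra.
Qed.

Lemma LagP (psi : 'rV[R]_N) (i : 'I_N) (x : 'rV[R]_n) : (0 < N)%N ->
  Lag X y c psi i x <->
  X x /\ forall k, c x (y i) + psi ord0 i <= c x (y k) + psi ord0 k.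
Proof.
move=> N_gt0; split=> [[Xx ei]|[Xx ei]]; split=> //.
  by move=> k; have := c_transform_ge psi x k; rewrite -ei; lra.
have [k ek] := c_transform_attained psi x N_gt0.
apply/eqP; rewrite eq_le c_transform_ge ek/=.
by have := ei k; lra.
Qed.

Lemma bigcup_Lag (psi : 'rV[R]_N) : (0 < N)%N -> X = \bigcup_i Lag X y c psi i.
Proof.
move=> N_gt0; apply/seteqP; split => [x Xx|x [i _ []]//].
by have [i ei] := c_transform_attained psi x N_gt0; exists i.
Qed.

Lemma closed_Lag (psi : 'rV[R]_N) (i : 'I_N) :
  (0 < N)%N -> compact X -> Reg X y c -> closed (Lag X y c psi i).
Proof.
move=> N_gt0 cX reg.
have /choice[f fP] : forall k, exists f : 'rV[R]_n -> R, forall x, X x ->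
    f x = c x (y k) /\ {for x, continuous f}.
  move=> k; have [f [V [_ XV [fV _] fc]]] := reg k; exists f => x Xx.
  split; first exact: fc.
  by apply: differentiable_continuous; have [] := fV x (XV _ Xx).
have clX : closed X by apply: compact_closed => //; exact: norm_hausdorff.
move=> x clLx.
have Xx : X x by apply: clX; apply: closure_subset clLx => z [].
apply/LagP => //; split=> // k; rewrite leNgt; apply/negP => ki.
have [fi cfi] := fP i x Xx; have [fk cfk] := fP k x Xx.
have cfd : f i z - f k z @[z --> x] --> f i x - f k x by exact: (cvgB cfi cfk).
have /(cvgr_gt _ cfd)/clLx[z [/(LagP _ _ _ N_gt0)[Xz /(_ k)]]] :
    psi ord0 k - psi ord0 i < f i x - f k x.
  by rewrite fi fk; lra.
have [-> _] := fP i z Xz; have [-> _] := fP k z Xz.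
by move=> /=; lra.
Qed.

(** At the common point [x] of two cells of [psi1] the potentials of [psi1] are
tied; at a nearby point of the cell [i] of [psi2], those of [psi2] compare in
favour of [i]. The costs [c _ (y i)] and [c _ (y k)] each change by at most [K]
times the distance of these points, which explains the factor [2]. *)
Lemma potential_gap_le (psi1 psi2 : 'rV[R]_N) (i k : 'I_N) (K M : R)
    (x : 'rV[R]_n) :
  (0 < N)%N -> 0 <= K ->
  (forall j u v, X u -> X v -> `|c u (y j) - c v (y j)| <= K * enorm (u - v)) ->
  (forall u, X u -> enorm u <= M) ->
  Lag X y c psi2 i !=set0 ->
  Lag X y c psi1 i x -> Lag X y c psi1 k x ->
  (psi1 ord0 k - psi2 ord0 k) - (psi1 ord0 i - psi2 ord0 i) <=
    2 * K * hausdorff_dist (Lag X y c psi1 i) (Lag X y c psi2 i).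
Proof.
move=> N_gt0 K0 cK XM L2i Lix Lkx; apply/ler_addgt0Pr => e e0.
(* Dividing by [2 * K + 1] rather than [2 * K] covers [K = 0]. *)
pose e' := e / (2 * K + 1).
have K1 : 0 < 2 * K + 1 by lra.
have e'0 : 0 < e' by rewrite divr_gt0.
have [|z /(LagP _ _ _ N_gt0)[Xz /(_ k) zik] xz] :=
  @hausdorff_dist_near _ _ (Lag X y c psi1 i) _ M e' x _ L2i Lix e'0.
  by move=> u [Xu _]; exact: XM.
have [Xx /(_ i) xki] := (LagP _ _ _ N_gt0).1 Lkx.
have Kxz := ler_wpM2l K0 (ltW xz).
have Ke : 2 * K * e' <= e by rewrite mulrA ler_pdivrMr//; nra.
have := cK i x z Xx Xz; have := cK k x z Xx Xz; rewrite !ler_norml.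
move=> /andP[? ?] /andP[? ?]; rewrite mulrDr in Kxz.
by rewrite -mulrA; lra.
Qed.

End costs.

(** * The stability estimate *)

Theorem theorem1p14 (R : realType) (n : nat) (n_ge2 : (2 <= n)%N)
    (q_rho q_bdry q_c q_tw q_nabla q_exp q_cond q_det : \bar R) :
  exists C : R, 0 < C /\
  forall (N : nat) (X : set 'rV[R]_n) (y : 'I_N -> 'rV[R]_n)
    (c : 'rV[R]_n -> 'rV[R]_n -> R) (rho : 'rV[R]_n -> R)
    (P : 'I_N -> set 'rV[R]_n) (E L : 'I_N -> 'rV[R]_n -> 'rV[R]_n),
  (1 <= N)%N ->
  compact X -> lipschitz_boundary X -> injective y ->
  continuous_density X rho ->
  Reg X y c -> Twist X y c -> QC X y c P E L ->
  bounded_set X -> c_convex P E X ->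
  C0norm X rho = q_rho ->
  hausdorff_measure n.-1 (bdry X) = q_bdry ->
  cost_C2norm X y c = q_c ->
  eps_tw X y c = q_tw ->
  C_nabla X y c = q_nabla ->
  C_exp X P E L = q_exp ->
  C_cond P E = q_cond ->
  C_det P E = q_det ->
  forall psi1 psi2 : 'rV[R]_N,
  \sum_(i < N) (psi1 - psi2) ord0 i = 0 ->
  (forall i, Lag X y c psi1 i !=set0 /\ Lag X y c psi2 i !=set0) ->
  let m := maxe (min_lag_volume X y c psi1) (min_lag_volume X y c psi2) in
  (0 < m)%E ->
  (C0norm X (fun x => (c_transform y c psi1 x - c_transform y c psi2 x)%R)
   <= (C * N%:R ^+ 4
       * Num.sqrt (\sum_(i < N)
           hausdorff_dist (Lag X y c psi1 i) (Lag X y c psi2 i) ^+ 2)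
       / (fine m `^ (1 - n%:R^-1)))%:E)%E.
Proof.
(* The absolute values keep [K] nonnegative whatever [q_nabla] and [q_exp] are. *)
pose a := `|fine q_nabla|; pose b := `|fine q_exp|.
pose K := a * (b * b).
pose V := (2 * (b + 1)) ^+ n; pose D := V `^ (1 - n%:R^-1).
have a0 : 0 <= a by exact: normr_ge0.
have b0 : 0 <= b by exact: normr_ge0.
have K0 : 0 <= K by rewrite !mulr_ge0.
have D0 : 0 <= D by exact: powR_ge0.
exists (2 * K * D + 1); split; first by rewrite ltr_wpDl ?mulr_ge0.
move=> N X y c rho P E L N_gt0 cX _ _ _ reg _ qc _ _ _ _ _ _ nablaE expE _ _.
move=> psi1 psi2 psi0 Lag0 m m_gt0.
have le_a : (C_nabla X y c <= a%:E)%E.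
  apply: le_trans (le_fineK (C_nabla_lty cX reg)) _.
  by rewrite nablaE lee_fin ler_norm.
have le_b : (C_exp X P E L <= b%:E)%E.
  apply: le_trans (le_fineK (C_exp_lty cX qc)) _.
  by rewrite expE lee_fin ler_norm.
pose i0 := Ordinal N_gt0.
have [P0conv [PE0 XL0 [h [U [_ PU [hU _] hE]]] _] _] := qc i0.
have Xb x : X x -> enorm x <= b.
  move=> /XL0[PLx <-].
  by have [] := le_C01norm (C_exp_ge i0 le_b).1 PLx PLx.
have X_conn : connected X.
  have -> : X = h @` P i0.
    apply/seteqP; split=> [x /XL0[PLx ELx]|_ [p Pp <-]].
      by exists (L i0 x) => //; rewrite hE.
    by rewrite hE//; have [] := PE0 p Pp.
  apply: connected_continuous_connected; first exact: convex_connected.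
  apply: continuous_in_subspaceT => p /[!inE] Pp.
  by apply: differentiable_continuous; have [] := hU p (PU _ Pp).
have m_le : (m <= V%:E)%E.
  rewrite ge_max; apply/andP.
  by split; apply: le_trans (ereal_inf_lbound _) (lebesgue_rV_bounded_le b0 _);
    try (by exists i0); move=> x [/Xb].
have m_fin : (m < +oo)%E by apply: le_lt_trans m_le _; rewrite ltry.
have m0 : 0 < fine m by rewrite fine_gt0// m_gt0.
have mV : fine m <= V.
  rewrite -lee_fin fineK//; apply/fin_numP.
  by split; [rewrite gt_eqF// (lt_trans _ m_gt0) | rewrite lt_eqF].
set mm := fine m `^ _; set S := Num.sqrt _.
have mm0 : 0 < mm by exact: powR_gt0.
have mmD : mm <= D.
  apply: ge0_ler_powR => //.
  - by rewrite subr_ge0 invf_le1 ?ler1n ?ltr0n// ltnW// ltnW.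
  - by rewrite nnegrE ltW.
  - by rewrite nnegrE exprn_ge0// mulr_ge0// addr_ge0.
have S0 : 0 <= S by exact: sqrtr_ge0.
pose hd i := hausdorff_dist (Lag X y c psi1 i) (Lag X y c psi2 i).
have hdS i : hd i <= S.
  apply: le_trans (ler_norm _) _.
  rewrite -sqrtr_sqr ler_sqrt; last by apply: sumr_ge0 => k _; exact: sqr_ge0.
  by rewrite (bigD1 i)//= lerDl sumr_ge0// => k _; exact: sqr_ge0.
have cK j u v : X u -> X v -> `|c u (y j) - c v (y j)| <= K * enorm (u - v).
  by move=> Xu Xv; exact: (cost_lipschitz j reg qc le_a le_b).
pose d i := psi1 ord0 i - psi2 ord0 i.
have d_adj i k : Lag X y c psi1 i `&` Lag X y c psi1 k !=set0 ->
    `|d i - d k| <= 2 * K * S.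
  move=> [x [Lix Lkx]]; rewrite ler_norml lerNl opprB.
  have gap j l := @potential_gap_le R n N X y c psi1 psi2 j l K b x
    N_gt0 K0 cK Xb (Lag0 j).2.
  have K2 : 0 <= 2 * K by rewrite mulr_ge0.
  apply/andP; split.
    by rewrite (le_trans (gap _ _ Lix Lkx))// ler_wpM2l// hdS.
  by rewrite (le_trans (gap _ _ Lkx Lix))// ler_wpM2l// hdS.
have d_le i : `|d i| <= N%:R * (2 * K * S).
  apply: norm_le_oscillation i.
    by rewrite -[RHS]psi0; apply: eq_bigr => i _; rewrite !mxE.
  apply: (adjacency_oscillation X_conn (bigcup_Lag X y c psi1 N_gt0)) => //.
  - by move=> i; exact: closed_Lag.
  - by move=> i; exact: (Lag0 i).1.
  - by rewrite !mulr_ge0.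
apply: ge_ereal_sup => _ [x Xx <-]; rewrite lee_fin.
apply: (@le_trans _ _ (N%:R * (2 * K * S))); first exact: c_transform_dist_le.
rewrite ler_pdivlMr//.
have N4 : N%:R <= N%:R ^+ 4 :> R by rewrite ler_eXnr// ler1n.
apply: (@le_trans _ _ (N%:R ^+ 4 * (2 * K * S) * D)).
  apply: ler_pM => //; [by rewrite !mulr_ge0|exact: ltW|].
  by rewrite ler_wpM2r// !mulr_ge0.
have : 0 <= N%:R ^+ 4 * S by rewrite mulr_ge0// exprn_ge0.
by move: (N%:R ^+ 4) => N4' ?; nra.
Qed.
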